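(* Let $n\ge 1$ and $N\ge n$ be integers and let $m=m^{(n)}=(m_1,\dots,m_n)\in\mathbb{R}^n$. Then $m$ is realizable on $\mathbb{N}_N=\{0,1,\dots,N\}$ if and only if $$L_P(m)\ge 0\quad\text{and}\quad L_Q(m)\ge 0\qquad\text{for every }P\in\mathcal{P}_{n,N}\text{ and every }Q\in\mathcal{Q}_{n,N}.$$ Moreover, none of these conditions may be omitted (i.e. if any single one of these inequalities is dropped, the remaining ones no longer characterize realizability on $\mathbb{N}_N$).
   Context: A moment vector $m=(m_1,\dots,m_n)$ is an $n$-tuple of real numbers; by convention $m_0=1$. It is realizable on $\mathbb{X}\subset\mathbb{R}$ if there is a probability measure $\mu$ on $\mathbb{X}$ with $\int x^k\,d\mu(x)=m_k$ for $k=1,\dots,n$. For a polynomial $P(x)=\sum_{k=0}^n p_kx^k$ of degree at most $n$, $L_P(m)=\sum_{k=0}^n p_km_k$. $\mathcal{P}_{n,N}$ denotes the set of monic polynomials of degree $n$ which have $n$ distinct roots in $\mathbb{N}_N$ and are nonnegative on $\mathbb{N}_N$. $\mathcal{Q}_{n,N}$ denotes the set of polynomials of degree $n$ with leading term $-x^n$ which have $n$ distinct roots in $\mathbb{N}_N$ and are nonnegative on $\mathbb{N}_N$. *)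

(* Defs.v *)
From mathcomp Require Import all_boot all_order all_algebra.
From mathcomp Require Import all_classical all_reals all_analysis.

Set Implicit Arguments.
Unset Strict Implicit.
Unset Printing Implicit Defensive.

Import Order.TTheory GRing.Theory Num.Theory.
Import numFieldNormedType.Exports.

Local Open Scope classical_set_scope.
Local Open Scope ring_scope.

Definition NN {R : realType} (N : nat) : set R := [set k%:R | k in `I_N.+1].

(* The list [1 :: m] implements the convention [m_0 = 1]: its entry of index k
   is the paper's m_k, while the tuple [m] itself starts at m_1. *)
Definition moment {R : realType} {n : nat} (m : n.-tuple R) (k : nat) : R :=
  (1 :: m)`_k.

(* A probability measure on a Borel set X is a Borel probability measure on R
   with [mu X = 1].  Since the right-hand side of the moment equation is
   finite, that equation includes the integrability of x^k. *)
Definition realizable {R : realType} {n : nat} (X : set R) (m : n.-tuple R) :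
    Prop :=
  exists mu : probability (measurableTypeR R) R,
    mu X = 1%E /\
    forall k : nat, (1 <= k <= n)%N ->
      (\int[mu]_x (x ^+ k)%:E = (moment m k)%:E)%E.

(* Only used for polynomials P of degree at most n. *)
Definition L {R : realType} {n : nat} (P : {poly R}) (m : n.-tuple R) : R :=
  \sum_(k < n.+1) P`_k * moment m k.

Definition has_roots_in_NN {R : realType} (n N : nat) (P : {poly R}) : Prop :=
  #|[pred k : 'I_N.+1 | root P k%:R]| = n.

Definition nonneg_on {R : realType} (X : set R) (P : {poly R}) : Prop :=
  forall x, X x -> 0 <= P.[x].

Definition calP {R : realType} (n N : nat) : set {poly R} :=
  [set P : {poly R} | [/\ size P = n.+1, lead_coef P = 1,
               has_roots_in_NN n N P & nonneg_on (NN N) P]].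

Definition calQ {R : realType} (n N : nat) : set {poly R} :=
  [set Q : {poly R} | [/\ size Q = n.+1, lead_coef Q = -1,
               has_roots_in_NN n N Q & nonneg_on (NN N) Q]].

(* Main.v *)
From HB Require Import structures.
Require Import Defs.
From mathcomp Require Import all_boot all_order all_algebra.
From mathcomp Require Import all_classical all_reals all_analysis.

Set Implicit Arguments.
Unset Strict Implicit.
Unset Printing Implicit Defensive.

Import Order.TTheory GRing.Theory Num.Theory.
Import numFieldNormedType.Exports.

Local Open Scope classical_set_scope.
Local Open Scope ring_scope.

(** Measures on N_N are finite vectors of weights, so by Farkas' lemma m is
    realizable iff L_F(m) >= 0 for every F of degree at most n that is
    nonnegative on N_N.  Such an F with fewer than n zeros on N_N is reduced to
    polynomials with more zeros there: let G be the monic polynomial vanishing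
    simply at the zeros of F and at one further node, and move F along G and -G
    until a new zero appears.  With n zeros, F is a positive multiple of an
    element of P_{n,N} or Q_{n,N}.  These are the facets of a full-dimensional
    polytope, and moving from the centre of one facet slightly outwards violates
    the corresponding inequality only. *)

(** * Farkas' lemma by induction on the inequalities *)

(** Let [a] be the first row of [A]. If the other rows already imply the inequality for [b], then
    [a] gets weight 0. Otherwise some [x0] obeys those rows but violates both [a] and [b], and
    projecting along it removes [a] from the system. *)
Lemma farkas (R : realFieldType) (m p : nat) (A : 'M[R]_(m, p)) (b : 'rV[R]_p) :
  (forall x : 'cV_p, (forall i, (A *m x) i 0 <= 0) -> (b *m x) 0 0 <= 0) ->
  exists2 w : 'rV[R]_m, forall i, 0 <= w 0 i & b = w *m A.
Proof.
elim: m A b => [|m IHm] A b Ab.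
  exists 0 => [i|]; first by rewrite mxE.
  rewrite mul0mx; apply/rowP => j; rewrite mxE.
  (* With no rows every [x] is admissible, in particular both signs of each unit vector, so
     [b = 0]. *)
  have b_le0 (x : 'cV_p) : (b *m x) 0 0 <= 0 by apply: Ab => -[].
  have bj s : (b *m (s *: delta_mx j 0 : 'cV_p)) 0 0 = s * b 0 j.
    by rewrite -scalemxAr -colE !mxE.
  apply/eqP; rewrite eq_le.
  have := b_le0 (1 *: delta_mx j 0); have := b_le0 (-1 *: delta_mx j 0).
  by rewrite !bj mul1r mulN1r oppr_le0 => -> ->.
pose a := usubmx (A : 'M[R]_(1 + m, p)); pose B := dsubmx (A : 'M[R]_(1 + m, p)).
have defA : A = col_mx a B by rewrite vsubmxK.
have AxE (x : 'cV_p) (i : 'I_(1 + m)) :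
    (A *m x) i 0 = (col_mx (a *m x) (B *m x)) i 0 by rewrite -mul_col_mx -defA.
have [/IHm [w w_ge0 bw]|] :=
    pselect (forall x : 'cV_p,
      (forall i, (B *m x) i 0 <= 0) -> (b *m x) 0 0 <= 0).
  exists (row_mx (0 : 'M[R]_1) w : 'rV_(1 + m)) => [i|].
    by rewrite mxE; case: splitP => j _ //; rewrite mxE.
  have := mul_row_col (0 : 'M[R]_1) w a B.
  by rewrite mul0mx add0r -bw -defA => ->.
case/existsNP => x0 /not_implyP [Bx0 /negP]; rewrite -ltNge => bx0.
have ax0 : 0 < (a *m x0) 0 0.
  rewrite ltNge; apply: contraTN bx0 => ax0; rewrite -leNgt; apply: Ab => i.
  rewrite AxE mxE; case: splitP => j _ //.
  by rewrite (ord1 j).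
pose x1 := ((a *m x0) 0 0)^-1 *: x0.
have ax1 : a *m x1 = 1%:M.
  apply/matrixP => i j; rewrite !ord1 -scalemxAr !mxE mulVf //.
  by have := lt0r_neq0 ax0; rewrite mxE.
have Bx1 i : (B *m x1) i 0 <= 0.
  by rewrite -scalemxAr mxE mulr_ge0_le0 // invr_ge0 ltW.
have bx1 : 0 < (b *m x1) 0 0 by rewrite -scalemxAr mxE mulr_gt0 ?invr_gt0.
(* Projecting along x1 onto the hyperplane a = 0 makes the constraint a void. *)
have [w w_ge0 bw] : exists2 w : 'rV_m, forall i, 0 <= w 0 i &
    b - b *m x1 *m a = w *m (B - B *m x1 *m a).
  apply: IHm => x Bx.
  have projE k (C : 'M[R]_(k, p)) :
      C *m (x - x1 *m (a *m x)) = (C - C *m x1 *m a) *m x.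
    by rewrite mulmxBr mulmxBl !mulmxA.
  rewrite -projE; apply: Ab => i; rewrite AxE mxE.
  case: splitP => j _; last by rewrite projE.
  by rewrite projE ax1 mul1mx subrr mul0mx mxE.
(* The weight of [a] is forced by evaluation at [x1], where [a] equals 1. It is nonnegative since
   [b] is positive at [x1] while [w *m B] is at most 0 there. *)
exists (row_mx (b *m x1 - w *m B *m x1) w : 'rV_(1 + m)) => [i|]; last first.
  have := mul_row_col (b *m x1 - w *m B *m x1) w a B; rewrite -defA => ->.
  rewrite mulmxBl -[LHS](subrK (b *m x1 *m a)) bw.
  by rewrite mulmxBr !mulmxA addrC addrA [RHS]addrAC.
rewrite mxE; case: splitP => j _ //; rewrite ord1 mxE [X in _ + X]mxE subr_ge0.
apply: le_trans (ltW bx1); rewrite -mulmxA mxE sumr_le0 // => k _.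
by rewrite mulr_ge0_le0.
Qed.

(** * Measures on the nodes as vectors of weights *)

(** The complement of the nodes is a null set, so [f] agrees almost everywhere with a finite
    combination of indicators of singletons. *)
Lemma integral_NN (R : realType) (N : nat)
    (mu : probability (measurableTypeR R) R) (f : R -> R) :
    measurable_fun setT f -> mu (NN N) = 1%E ->
  (\int[mu]_x (f x)%:E =
     \sum_(i < N.+1) (f i%:R)%:E * mu [set i%:R : measurableTypeR R])%E.
Proof.
move=> mf muN.
have mNN : measurable (NN N : set (measurableTypeR R)).
  apply: countable_measurable => [t|]; first exact: measurable_set1.
  apply: finite_set_countable; exact/finite_image/finite_II.
have m1 (i : nat) : measurable [set i%:R : measurableTypeR R].
  exact: measurable_set1.
pose g i (x : measurableTypeR R) : \bar R :=
  ((f i%:R)%:E * (\1_[set i%:R] x)%:E)%E.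
have ig i : mu.-integrable setT (g i).
  by apply: integrableZl => //; apply: integrable_indic.
rewrite (ae_eq_integral (fun x => \sum_(i < N.+1) g i x)%E) //; last first.
- exists (~` NN N); split; first exact: measurableC.
    by have := probability_setC mu mNN; rewrite [X in (1 - X)%E]muN subee.
  apply: subsetC => _ [j /= jN <-] _.
  rewrite (bigD1 (Ordinal jN)) //= big1 => [|i ij].
    by rewrite /g indicE /= mem_set // mule1 adde0.
  rewrite /g indicE memNset ?mule0//= => /eqP; rewrite eqr_nat => /eqP ji.
  by case/eqP: ij; apply/val_inj.
- by apply: emeasurable_sum => i; apply: measurable_int (ig i).
- exact/measurable_realfun.measurable_EFinP.
rewrite integral_sum //; apply: eq_bigr => i _.
rewrite integralZl // ?integral_indic // ?setIT //.
exact: integrable_indic.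
Qed.

(** The weights are the point masses of the measure. The case [k = 0] carries the normalization: it
    makes the total mass 1. *)
Lemma realizable_NNP (R : realType) (n N : nat) (m : n.-tuple R) :
  realizable (NN N) m <-> exists2 w : 'I_N.+1 -> R, forall i, 0 <= w i &
    forall k, (k <= n)%N -> moment m k = \sum_i w i * i%:R ^+ k.
Proof.
split=> [[mu [muN mum]]|[w w_ge0 mw]].
  exists (fun i : 'I_N.+1 => fine (mu [set i%:R : measurableTypeR R])) => [i|k].
    exact: fine_ge0.
  have mui (i : 'I_N.+1) : mu [set i%:R : measurableTypeR R] \is a fin_num.
    by apply: fin_num_measure; exact: measurable_set1.
  move=> kn; apply: EFin_inj.
  transitivity (\int[mu]_x (x ^+ k)%:E)%E.
    case: k kn => [|k] kn; last by rewrite mum.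
    under eq_integral do rewrite expr0.
    rewrite integral_cst // mul1e; exact/esym/probability_setT.
  rewrite (integral_NN _ muN) // -sumEFin; apply: eq_bigr => i _.
  by rewrite EFinM fineK // muleC.
(* [msum] takes a sequence indexed by [nat], hence [inord]; only indices up to [N] enter, and it
   preserves their values. *)
pose d (k : nat) : {measure set (measurableTypeR R) -> \bar R} :=
  mscale (NngNum (w_ge0 (inord k))) (@dirac _ (measurableTypeR R) k%:R R).
have sumw : \sum_i w i = 1.
  by have /esym := mw 0 isT; under eq_bigr do rewrite expr0 mulr1.
have dE A : msum d N.+1 A = (\sum_(i < N.+1) (w i * \1_A (i%:R : R))%:E)%E.
  apply: eq_bigr => i _.
  by rewrite /d /= /mscale /= inord_val diracE EFinM indicE.
have d1 A : NN N `<=` A -> msum d N.+1 A = 1%E.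
  move=> NA; rewrite dE sumEFin.
  transitivity (\sum_i w i)%:E; last by rewrite sumw.
  congr EFin; apply: eq_bigr => i _.
  by rewrite indicE mem_set ?mulr1//; apply: NA; exists i => //; exact: ltn_ord.
pose nu : {measure set (measurableTypeR R) -> \bar R} := msum d N.+1.
pose dP := Measure_isProbability.Build _ _ _ nu (d1 _ (@subsetT _ _)).
pose mu : probability (measurableTypeR R) R := HB.pack (Measure.sort nu) dP.
have muN : mu (NN N) = 1%E by apply: (d1 (NN N)).
exists mu; split => // k /andP [k_gt0 kn].
rewrite (integral_NN _ muN) // mw // -sumEFin; apply: eq_bigr => i _.
have -> : mu [set i%:R] = (w i)%:E.
  rewrite /mu /= dE sumEFin; congr EFin; rewrite (bigD1 i) //= big1 => [|j ji].
    by rewrite indicE mem_set // mulr1 addr0.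
  rewrite indicE memNset ?mulr0 //= => /eqP; rewrite eqr_nat => /eqP jE.
  by case/eqP: ji; apply/val_inj.
by rewrite -EFinM mulrC.
Qed.

(** * Nodal polynomials and zeros at the nodes *)

Definition nodal (R : realType) (N : nat) (S : {set 'I_N.+1}) : {poly R} :=
  \prod_(k in S) ('X - k%:R%:P).

Definition zeros (R : realType) (N : nat) (F : {poly R}) : {set 'I_N.+1} :=
  [set k : 'I_N.+1 | root F k%:R]%SET.

Lemma nonneg_on_NNP (R : realType) (N : nat) (F : {poly R}) :
  nonneg_on (NN N) F <-> forall i : 'I_N.+1, 0 <= F.[i%:R].
Proof.
split=> [F_ge0 i|F_ge0 _ [i iN <-]].
  by apply: F_ge0; exists (i : nat); first exact: ltn_ord.
exact: (F_ge0 (Ordinal iN)).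
Qed.

Lemma exists_notin_ord (N : nat) (S : {set 'I_N.+1}) :
  (#|S| <= N)%N -> exists i, i \notin S.
Proof.
move=> SN; apply/existsP; rewrite -negb_forall; apply/negP => /forallP allS.
have : (#|'I_N.+1| <= #|S|)%N by apply/subset_leq_card/fintype.subsetP.
by rewrite card_ord leqNgt ltnS SN.
Qed.

Lemma size_nodal (R : realType) (N : nat) (S : {set 'I_N.+1}) :
  size (nodal R S) = #|S|.+1.
Proof. by rewrite /nodal -big_enum size_prod_XsubC -cardE. Qed.

Lemma monic_nodal (R : realType) (N : nat) (S : {set 'I_N.+1}) :
  nodal R S \is monic.
Proof. by rewrite /nodal -big_enum monic_prod_XsubC. Qed.

Lemma horner_nodal (R : realType) (N : nat) (S : {set 'I_N.+1}) x :
  (nodal R S).[x] = \prod_(k in S) (x - k%:R).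
Proof. by rewrite horner_prod; apply: eq_bigr => k _; rewrite hornerXsubC. Qed.

Lemma zeros_nodal (R : realType) (N : nat) (S : {set 'I_N.+1}) :
  zeros N (nodal R S) = S.
Proof.
apply/setP => i; rewrite inE rootE horner_nodal.
apply/idP/idP => [/prodf_eq0[k kS]|iS].
  by rewrite subr_eq0 eqr_nat => /eqP/val_inj ->.
by rewrite (bigD1 i) //= subrr mul0r.
Qed.

Lemma has_rootsE (R : realType) (n N : nat) (F : {poly R}) :
  has_roots_in_NN n N F <-> #|zeros N F| = n.
Proof. by rewrite /zeros cardsE. Qed.

Lemma zeros_all_root (R : realType) (N : nat) (F : {poly R}) :
  let rs := [seq (k : nat)%:R | k : 'I_N.+1 <- enum (zeros N F)] in
  all (root F) rs /\ uniq rs.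
Proof.
split; first by apply/allP => _ /mapP[k + ->]; rewrite mem_enum inE.
rewrite map_inj_uniq ?enum_uniq // => i j /eqP.
by rewrite eqr_nat => /eqP/val_inj.
Qed.

Lemma card_zeros_lt_size (R : realType) (N : nat) (F : {poly R}) :
  F != 0 -> (#|zeros N F| < size F)%N.
Proof.
move=> F0; have [rF uF] := zeros_all_root N F.
by have := max_poly_roots F0 rF uF; rewrite size_map -cardE.
Qed.

(** The distinct zeros at nodes exhaust the degree, so [F] has no other zeros and all are simple. *)
Lemma scale_nodal_zeros (R : realType) (N : nat) (F : {poly R}) :
  size F = #|zeros N F|.+1 -> F = lead_coef F *: nodal R (zeros N F).
Proof.
move=> sF; have [rF uF] := zeros_all_root N F.
rewrite {1}(all_roots_prod_XsubC _ rF) ?uniq_rootsE ?size_map -?cardE //.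
by rewrite big_map /nodal -big_enum.
Qed.

(** * The functional [L] and duality *)

Lemma LB (R : realType) (n : nat) (m : n.-tuple R) (F G : {poly R}) :
  L (F - G) m = L F m - L G m.
Proof.
rewrite /L -sumrB; apply: eq_bigr => k _.
by rewrite coefB mulrBl.
Qed.

Lemma LZ (R : realType) (n : nat) (m : n.-tuple R) (a : R) (F : {poly R}) :
  L (a *: F) m = a * L F m.
Proof.
by rewrite /L mulr_sumr; apply: eq_bigr => k _; rewrite coefZ mulrA.
Qed.

Lemma L0 (R : realType) (n : nat) (m : n.-tuple R) : L 0 m = 0.
Proof. by rewrite -(scale0r 0) LZ mul0r. Qed.

Lemma LN (R : realType) (n : nat) (m : n.-tuple R) (F : {poly R}) :
  L (- F) m = - L F m.
Proof. by rewrite -[- F]sub0r LB L0 sub0r. Qed.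

Lemma L_quadrature (R : realType) (n N : nat) (m : n.-tuple R)
    (w : 'I_N.+1 -> R) (F : {poly R}) :
    (forall k, (k <= n)%N -> moment m k = \sum_i w i * i%:R ^+ k) ->
  (size F <= n.+1)%N -> L F m = \sum_i w i * F.[i%:R].
Proof.
move=> mw sF.
under [RHS]eq_bigr do rewrite (horner_coef_wide _ sF) mulr_sumr.
rewrite exchange_big; apply: eq_bigr => k _ /=.
rewrite (mw k (ltn_ord k)) mulr_sumr; apply: eq_bigr => i _.
by rewrite mulrCA.
Qed.

(** The rows of [A] are the points (1, i, ..., i^n) of the moment curve; realizability means that
    the row [b] of moments lies in the cone they span. *)
Lemma realizable_L_ge0 (R : realType) (n N : nat) (m : n.-tuple R) :
  realizable (NN N) m <-> forall F : {poly R},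
    (size F <= n.+1)%N -> nonneg_on (NN N) F -> 0 <= L F m.
Proof.
rewrite realizable_NNP; split=> [[w w_ge0 mw] F sF /nonneg_on_NNP F_ge0|m_ge0].
  by rewrite (L_quadrature mw sF) sumr_ge0 // => i _; rewrite mulr_ge0.
pose A : 'M[R]_(N.+1, n.+1) := \matrix_(i, j) (i%:R ^+ j).
pose b : 'rV[R]_n.+1 := \row_j moment m j.
have [x Ax|w w_ge0 bw] := @farkas _ _ _ A b.
  (* The test vector [x] holds the coefficients of [- F], so that [A *m x <= 0] reads as
     nonnegativity of [F] at the nodes. *)
  pose F : {poly R} := \poly_(j < n.+1) - x (inord j) 0.
  have sF : (size F <= n.+1)%N by apply: size_poly.
  have Fj (j : 'I_n.+1) : F`_j = - x j 0.
    by rewrite coef_poly ltn_ord inord_val.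
  have -> : (b *m x) 0 0 = - L F m.
    rewrite mxE /L -sumrN; apply: eq_bigr => j _.
    by rewrite Fj mxE mulNr opprK mulrC.
  rewrite oppr_le0; apply: m_ge0 => //; apply/nonneg_on_NNP => i.
  have -> : F.[i%:R] = - (A *m x) i 0; last by rewrite oppr_ge0.
  rewrite (horner_coef_wide _ sF) mxE -sumrN; apply: eq_bigr => j _.
  by rewrite Fj mxE mulNr mulrC.
exists (w 0) => // k kn.
have /rowP/(_ (Ordinal (kn : (k < n.+1)%N))) := bw.
by rewrite !mxE => ->; apply: eq_bigr => i _; rewrite mxE.
Qed.

(** * Reduction to polynomials with n zeros at the nodes *)

Lemma L_ge0_facets (R : realType) (n N : nat) (m : n.-tuple R) (F : {poly R}) :
    (n <= N)%N ->
    (forall P : {poly R}, calP n N P -> 0 <= L P m) ->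
    (forall Q : {poly R}, calQ n N Q -> 0 <= L Q m) ->
  (size F <= n.+1)%N -> nonneg_on (NN N) F -> 0 <= L F m.
Proof.
move=> nN P_ge0 Q_ge0 + /nonneg_on_NNP.
(* Induction on a bound [k] for the zeros still missing. At [k = 0] there are more than [n] zeros in
   degree at most [n], which forces [F = 0]. *)
have [k] : exists k, (n < k + #|zeros N F|)%N.
  by exists n.+1; rewrite leq_addr.
 elim: k F => [|k IHk] F nk sF F_ge0;
    have [->|F0] := eqVneq F 0; rewrite ?L0 //.
  by have := leq_trans (card_zeros_lt_size N F0) sF; rewrite ltnS leqNgt nk.
have Sn : (#|zeros N F| <= n)%N.
  by rewrite -ltnS (leq_trans (card_zeros_lt_size N F0)).
case: (ltngtP #|zeros N F| n) Sn => // [{}Sn _|Sn _]; last first.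
  have sF' : size F = n.+1.
    by apply/eqP; rewrite eqn_leq sF -[in X in (X < _)%N]Sn card_zeros_lt_size.
  have lF0 : lead_coef F != 0 by rewrite lead_coef_eq0.
  have scaled (a : R) : 0 < a ->
      [/\ size (a *: F) = n.+1, lead_coef (a *: F) = a * lead_coef F,
          has_roots_in_NN n N (a *: F) & nonneg_on (NN N) (a *: F)].
    move=> a_gt0; have a0 := lt0r_neq0 a_gt0.
    split; rewrite ?size_scale ?lead_coefZ //.
      apply/has_rootsE; rewrite -[RHS]Sn; apply: eq_card => i.
      by rewrite !inE rootZ.
    by apply/nonneg_on_NNP => i; rewrite hornerZ mulr_ge0 // ltW.
  (* Positive scaling makes the leading coefficient 1 or -1, and its sign decides between [calP] and
     [calQ]. *)
  have a_gt0 : 0 < `|lead_coef F|^-1 by rewrite invr_gt0 normr_gt0.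
  suff: 0 <= L (`|lead_coef F|^-1 *: F) m by rewrite LZ pmulr_rge0.
  have [sG lG rG G_ge0] := scaled _ a_gt0.
  have /orP[l_lt0|l_gt0] : (lead_coef F < 0) || (0 < lead_coef F).
  - by rewrite -neq_lt.
  - by apply: Q_ge0; split=> //; rewrite lG ltr0_norm // invrN mulNr mulVf.
  - by apply: P_ge0; split=> //; rewrite lG gtr0_norm // mulVf.
(* The extra node gives the direction more zeros than [F], so the induction hypothesis applies to
   the direction itself when it has constant sign on the nodes. *)
have [x0 x0S] : exists x0, x0 \notin zeros N F.
  by apply: exists_notin_ord; rewrite ltnW // (leq_trans Sn).
pose T := (x0 |: zeros N F)%SET.
have cT : #|T| = #|zeros N F|.+1 by rewrite cardsU1 x0S.
have IH (H : {poly R}) : (size H <= n.+1)%N ->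
    (forall i : 'I_N.+1, 0 <= H.[i%:R]) ->
    (#|zeros N F| < #|zeros N H|)%N -> 0 <= L H m.
  move=> sH H_ge0 FH; apply: IHk => //.
  by apply: leq_trans nk _; rewrite addSnnS leq_add2l.
(* Moving from F in the direction -G until a new zero appears. *)
have move_le (G : {poly R}) (i0 : 'I_N.+1) :
    (size G <= n.+1)%N -> T \subset zeros N G ->
    0 < G.[i0%:R] -> exists2 t, 0 < t & t * L G m <= L F m.
  move=> sG TG Gi0.
  (* Ratio test: the least quotient over nodes with [G > 0] is the longest step keeping [F - t G]
     nonnegative. Its minimizer becomes a new zero, and the old zeros survive because [G] vanishes
     there. *)
  pose q (i : 'I_N.+1) := F.[i%:R] / G.[i%:R].
  have [i1 Gi1 qmin] :=
    @arg_minP _ _ _ i0 (fun i : 'I_N.+1 => 0 < G.[i%:R]) q Gi0.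
  have SG i : i \in zeros N F -> G.[i%:R] = 0.
    move=> iS; have /(fintype.subsetP TG) : i \in T by rewrite inE iS orbT.
    by rewrite inE => /rootP.
  have q_gt0 : 0 < q i1.
    rewrite divr_gt0 // lt_neqAle F_ge0 andbT eq_sym -rootE.
    apply: contraTN Gi1 => rFi1; rewrite SG ?inE //.
    by rewrite ltxx.
  exists (q i1) => //.
  rewrite -subr_ge0 -LZ -LB; apply: IH => [|i|].
  - rewrite (leq_trans (size_polyD _ _)) // geq_max sF size_polyN.
    by rewrite (leq_trans (size_scale_leq _ _)).
  - rewrite hornerD hornerN hornerZ subr_ge0.
    have [Gi|Gi] := ltP 0 G.[i%:R].
      by rewrite -ler_pdivlMr // qmin.
    by rewrite (le_trans _ (F_ge0 i)) // mulr_ge0_le0 // ltW.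
  - have i1S : i1 \notin zeros N F.
      by apply: contraTN Gi1 => /SG ->; rewrite ltxx.
    have -> : #|zeros N F|.+1 = #|(i1 |: zeros N F)%SET| by rewrite cardsU1 i1S.
    apply/subset_leq_card/fintype.subsetP => i; rewrite !inE !rootE.
    rewrite hornerD hornerN hornerZ => /orP[/eqP ->|iS].
      by rewrite /q divfK ?subrr // gt_eqF.
    by rewrite SG ?inE // mulr0 subr0.
have toward (G : {poly R}) :
    (size G <= n.+1)%N -> T \subset zeros N G -> G != 0 ->
    0 <= L G m -> 0 <= L F m.
  move=> sG TG G0 LG.
  have [/existsP[i Gi]|] := boolP [exists i : 'I_N.+1, 0 < G.[i%:R]].
    have [t t_gt0] := move_le G i sG TG Gi.
    by apply: le_trans; rewrite mulr_ge0 // ltW.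
  (* With [G <= 0] on all nodes no new zero arises along [G]. Then [- G] is nonnegative with more
     zeros than [F], so [L (- G) m >= 0] by induction, and the move goes along [- G] instead. *)
  rewrite negb_exists => /forallP G_le0.
  have NG_ge0 (i : 'I_N.+1) : 0 <= (- G).[i%:R].
    by rewrite hornerN oppr_ge0 leNgt.
  have sNG : (size (- G) <= n.+1)%N by rewrite size_polyN.
  have TNG : T \subset zeros N (- G).
    apply: fintype.subset_trans TG _; apply/fintype.subsetP => i.
    by rewrite !inE rootN.
  have [i Gi] : exists i, i \notin zeros N G.
    apply: exists_notin_ord; rewrite (leq_trans _ nN) // -ltnS.
    exact: leq_trans (card_zeros_lt_size N G0) sG.
  have NGi : 0 < (- G).[i%:R].
    rewrite lt_neqAle NG_ge0 hornerN eq_sym oppr_eq0 andbT -rootE.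
    by rewrite inE in Gi.
  have [t t_gt0] := move_le _ i sNG TNG NGi.
  apply: le_trans; rewrite mulr_ge0 ?IH ?(ltW t_gt0) //.
  by rewrite -cT subset_leq_card.
have sG : (size (nodal R T) <= n.+1)%N by rewrite size_nodal cT.
(* One of the two opposite directions has a nonnegative value of [L]. *)
have [LG|LG] := leP 0 (L (nodal R T) m).
  by apply: toward LG => //; rewrite ?zeros_nodal // monic_neq0 // monic_nodal.
apply: (toward (- nodal R T)).
- by rewrite size_polyN.
- apply/fintype.subsetP => i; rewrite -[in X in X -> _](zeros_nodal R T).
  by rewrite !inE rootN.
- by rewrite oppr_eq0 monic_neq0 // monic_nodal.
- by rewrite LN oppr_ge0 ltW.
Qed.

(** * Independence of the inequalities *)

Lemma moments_of_weights (R : realType) (n N : nat) (w : 'I_N.+1 -> R) :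
  \sum_i w i = 1 -> exists m : n.-tuple R,
    forall k, (k <= n)%N -> moment m k = \sum_i w i * i%:R ^+ k.
Proof.
move=> w1; exists [tuple \sum_i w i * i%:R ^+ j.+1 | j < n] => -[|k] kn.
  by rewrite /moment /=; under eq_bigr do rewrite expr0 mulr1.
exact: (nth_mktuple _ 0 (Ordinal kn)).
Qed.

Lemma natr_dist_ge1 (R : realType) (a b : nat) :
  a != b -> 1 <= `|a%:R - b%:R : R|.
Proof.
wlog ab : a b / (a < b)%N => [hw|_].
  rewrite neq_ltn => /orP[ab|ba]; last rewrite distrC.
    by apply: hw; rewrite // ltn_eqF.
  by apply: hw; rewrite // ltn_eqF.
by rewrite distrC -natrB ?(ltnW ab) // normr_nat ler1n subn_gt0.
Qed.

Lemma natr_dist_le (R : realType) (N a b : nat) :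
  (a <= N)%N -> (b <= N)%N -> `|a%:R - b%:R : R| <= N%:R.
Proof.
wlog ab : a b / (a <= b)%N => [hw|] aN bN.
  have /orP[ab|ba] := leq_total a b; first exact: hw.
  by rewrite distrC; apply: hw.
by rewrite distrC -natrB // normr_nat ler_nat (leq_trans (leq_subr _ _)).
Qed.

(** Treats [calP] and [calQ] together by leaving the sign of the leading coefficient open. *)
Definition facet_poly (R : realType) (n N : nat) (F : {poly R}) : Prop :=
  [/\ size F = n.+1, `|lead_coef F| = 1, has_roots_in_NN n N F
    & nonneg_on (NN N) F].

Lemma calP_facet (R : realType) (n N : nat) (P : {poly R}) :
  calP n N P -> facet_poly n N P.
Proof. by case=> sP lP rP P_ge0; split; rewrite // lP normr1. Qed.

Lemma calQ_facet (R : realType) (n N : nat) (Q : {poly R}) :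
  calQ n N Q -> facet_poly n N Q.
Proof. by case=> sQ lQ rQ Q_ge0; split; rewrite // lQ normrN1. Qed.

Lemma facet_polyE (R : realType) (n N : nat) (F : {poly R}) :
  facet_poly n N F -> F = lead_coef F *: nodal R (zeros N F).
Proof. by case=> sF _ /has_rootsE rF _; apply: scale_nodal_zeros; rewrite rF. Qed.

Lemma norm_facet (R : realType) (n N : nat) (F : {poly R}) (i : 'I_N.+1) :
  facet_poly n N F -> `|F.[i%:R]| = \prod_(k in zeros N F) `|i%:R - k%:R|.
Proof.
move=> FF; rewrite {1}(facet_polyE FF); case: FF => _ lF _ _.
by rewrite hornerZ normrM lF mul1r horner_nodal normr_prod.
Qed.

(** The value is, up to sign, a product of distances between distinct integers. *)
Lemma facet_ge1 (R : realType) (n N : nat) (F : {poly R}) (i : 'I_N.+1) :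
  facet_poly n N F -> i \notin zeros N F -> 1 <= F.[i%:R].
Proof.
move=> FF iF; have [_ _ _ /nonneg_on_NNP F_ge0] := FF.
rewrite -(ger0_norm (F_ge0 i)) (norm_facet _ FF).
apply: (big_ind (fun y : R => 1 <= y)) => // [y z y1 z1|k kF].
  exact: mulr_ege1.
by apply: natr_dist_ge1; apply: contraNN iF => /eqP/val_inj ->.
Qed.

Lemma facet_le (R : realType) (n N : nat) (F : {poly R}) (i : 'I_N.+1) :
  facet_poly n N F -> F.[i%:R] <= N%:R ^+ n.
Proof.
move=> FF; have [_ _ /has_rootsE rF /nonneg_on_NNP F_ge0] := FF.
rewrite -(ger0_norm (F_ge0 i)) (norm_facet _ FF) -rF -prodr_const.
apply: ler_prod => k _; rewrite normr_ge0 natr_dist_le //.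
  exact: leq_ord.
exact: leq_ord.
Qed.

(** Both have [n] zeros, so inclusion is equality and the zeros fix the polynomial up to sign.
    Nonnegativity at a node that is not a zero fixes the sign; [n <= N] provides such a node. *)
Lemma facet_inj (R : realType) (n N : nat) (F G : {poly R}) :
    (n <= N)%N -> facet_poly n N F -> facet_poly n N G ->
  zeros N F \subset zeros N G -> F = G.
Proof.
move=> nN FF FG sFG.
have [_ lF /has_rootsE rF /nonneg_on_NNP F_ge0] := FF.
have [_ lG /has_rootsE rG /nonneg_on_NNP G_ge0] := FG.
have /eqP zE : zeros N F == zeros N G by rewrite eqEcard sFG rF rG leqnn.
have [i iF] : exists i, i \notin zeros N F.
  by apply: exists_notin_ord; rewrite rF.
have iG : i \notin zeros N G by rewrite -zE.
have F1 := lt_le_trans ltr01 (facet_ge1 FF iF).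
have G1 := lt_le_trans ltr01 (facet_ge1 FG iG).
rewrite (facet_polyE FF) (facet_polyE FG) zE; congr (_ *: _).
have FGE : lead_coef G * F.[i%:R] = lead_coef F * G.[i%:R].
  by rewrite {1}(facet_polyE FF) {2}(facet_polyE FG) zE !hornerZ mulrCA.
have nE : F.[i%:R] = G.[i%:R].
  rewrite -(gtr0_norm F1) -(gtr0_norm G1).
  by rewrite (norm_facet _ FF) (norm_facet _ FG) zE.
by apply: (mulIf (lt0r_neq0 G1)); rewrite -FGE nE.
Qed.

(* The witness is the mean of the zeros of F0, pushed slightly away from another
   node; the uniform step size works since a facet polynomial takes values in
   {0} `|` [1, N ^ n] on the nodes. *)
Lemma facet_separated (R : realType) (n N : nat) (F0 : {poly R}) :
    (1 <= n)%N -> (n <= N)%N -> facet_poly n N F0 ->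
  exists2 m : n.-tuple R, L F0 m < 0
    & forall F, facet_poly n N F -> F <> F0 -> 0 <= L F m.
Proof.
move=> n_ge1 nN FF0; set S := zeros N F0.
have [_ _ /has_rootsE rF0 _] := FF0.
have [x xS] : exists x, x \notin S.
  by apply: exists_notin_ord; rewrite rF0.
have n_gt0 : 0 < n%:R :> R by rewrite ltr0n.
have M_gt0 : 0 < n%:R * N%:R ^+ n :> R.
  by rewrite mulr_gt0 // exprn_gt0 // ltr0n (leq_trans n_ge1).
pose e : R := (n%:R * N%:R ^+ n)^-1.
have e_gt0 : 0 < e by rewrite invr_gt0.
(* A signed weight of total mass 1: [1 + e] spread evenly over [S], and [- e] at [x]. The negative
   mass alone is seen by [F0]. *)
pose w i : R := (1 + e) / n%:R * (i \in S)%:R - e * (i == x)%:R.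
have wE (f : 'I_N.+1 -> R) :
    \sum_i w i * f i = (1 + e) / n%:R * (\sum_(i in S) f i) - e * f x.
  under eq_bigr do rewrite mulrBl -!mulrA.
  rewrite big_split /= sumrN -!mulr_sumr -[in RHS]mulrA.
  congr (_ * (_ * _) - e * _).
    rewrite [RHS]big_mkcond /=; apply: eq_bigr => i _.
    by case: (i \in S); rewrite ?mul1r ?mul0r.
  rewrite (bigD1 x) //= eqxx mul1r big1 ?addr0 // => i /negbTE ->.
  by rewrite mul0r.
have [|m mw] := @moments_of_weights R n N w.
  under eq_bigr do rewrite -[w _]mulr1.
  by rewrite wE sumr_const rF0 mulr1 divfK ?gt_eqF // addrK.
have LE F : facet_poly n N F ->
    L F m = (1 + e) / n%:R * (\sum_(i in S) F.[i%:R]) - e * F.[x%:R].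
  by case=> sF _ _ _; rewrite (L_quadrature mw) ?sF // wE.
exists m => [|F FF FF0'].
  rewrite LE // big1 => [|i]; last by rewrite inE => /rootP.
  rewrite mulr0 sub0r oppr_lt0 mulr_gt0 //.
  exact: lt_le_trans ltr01 (facet_ge1 FF0 xS).
have [_ _ _ /nonneg_on_NNP F_ge0] := FF.
have [s sS sF] : exists2 s, s \in S & s \notin zeros N F.
  apply/fintype.subsetPn; apply/negP => SF; apply: FF0'.
  exact/esym/(facet_inj nN FF0 FF).
have sum_ge1 : 1 <= \sum_(i in S) F.[i%:R].
  rewrite (bigD1 s) //= -[leLHS]addr0 lerD //.
    exact: facet_ge1 FF sF.
  exact: sumr_ge0.
(* The loss at [x] is at most [e * N ^ n = 1 / n], and the gain on [S] is at least [(1 + e) / n]. *)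
rewrite LE // subr_ge0.
apply: (@le_trans _ _ n%:R^-1).
  rewrite -ler_pdivlMl // /e invrK mulrAC divff ?gt_eqF // mul1r.
  exact: facet_le FF.
rewrite -[leLHS]mulr1 ler_pM // ?invr_ge0 ?ltW //.
by rewrite -[ltLHS]mul1r ltr_pM2r ?invr_gt0 // ltrDl.
Qed.

(** * Characterization of realizability and necessity of each inequality *)

Theorem theorem2p2 (R : realType) (n N : nat) (n_ge1 : (1 <= n)%N)
    (n_le_N : (n <= N)%N) :
  [/\ forall m : n.-tuple R,
        realizable (NN N) m <->
        (forall P : {poly R}, calP n N P -> 0 <= L P m) /\
        (forall Q : {poly R}, calQ n N Q -> 0 <= L Q m),
      forall P0 : {poly R}, calP n N P0 ->
        ~ (forall m : n.-tuple R,
             realizable (NN N) m <->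
             (forall P : {poly R}, calP n N P -> P <> P0 -> 0 <= L P m) /\
             (forall Q : {poly R}, calQ n N Q -> 0 <= L Q m))
    & forall Q0 : {poly R}, calQ n N Q0 ->
        ~ (forall m : n.-tuple R,
             realizable (NN N) m <->
             (forall P : {poly R}, calP n N P -> 0 <= L P m) /\
             (forall Q : {poly R}, calQ n N Q -> Q <> Q0 -> 0 <= L Q m))].
Proof.
(* Keeps [calP] and [calQ] disjoint, so omitting a member of one family leaves the other family
   intact. *)
have N1_neq1 : (-1 : R) <> 1.
  by move/eqP; rewrite -subr_eq0 -opprD oppr_eq0 (pnatr_eq0 R 2).
have facet_realizable (m : n.-tuple R) F :
    realizable (NN N) m -> facet_poly n N F -> 0 <= L F m.
  by move=> /realizable_L_ge0 m_ge0 [sF _ _ F_ge0]; apply: m_ge0; rewrite ?sF.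
split=> [m|P0 PP0 mP|Q0 QQ0 mQ].
- split=> [m_real|[P_ge0 Q_ge0]].
    split=> F; first by move/calP_facet; apply: facet_realizable.
    by move/calQ_facet; apply: facet_realizable.
  by apply/realizable_L_ge0 => F; apply: L_ge0_facets n_le_N P_ge0 Q_ge0.
- have FP0 := calP_facet PP0.
  have [m P0m Fm] := facet_separated n_ge1 n_le_N FP0.
  suff /facet_realizable/(_ FP0) : realizable (NN N) m by rewrite leNgt P0m.
  apply/mP; split=> [P /calP_facet/Fm//|Q QQ]; apply: Fm (calQ_facet QQ) _ => QP0.
  have [[_ lP _ _] [_ lQ _ _]] := (PP0, QQ).
  by apply: N1_neq1; rewrite -lQ QP0.
- have FQ0 := calQ_facet QQ0.
  have [m Q0m Fm] := facet_separated n_ge1 n_le_N FQ0.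
  suff /facet_realizable/(_ FQ0) : realizable (NN N) m by rewrite leNgt Q0m.
  apply/mQ; split=> [P PP|Q /calQ_facet/Fm//]; apply: Fm (calP_facet PP) _ => PQ0.
  have [[_ lP _ _] [_ lQ _ _]] := (PP, QQ0).
  by apply: N1_neq1; rewrite -lQ -PQ0.
Qed.
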